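(* Let $0<\epsilon\le 1/256$, $s=\lfloor 1/(16\epsilon)\rfloor$, and let $(\xi_i)_{1\le i\le s}$ be any admissible HLM realization, with associated block dimensions $d_1,\dots,d_s$, group $G=\mathbb F_2^{\,n}$ and level sets $A_1,\dots,A_s\subseteq G$ (all defined in the context). Then for every $1\le i\le s$ and every integer $1\le k\le d_i$, there are explicit vectors in $G$ witnessing the $k$-order property of $A_i$; that is, there are $a_1,\dots,a_k,b_1,\dots,b_k\in G$ such that $a_p+b_q\in A_i$ if and only if $p\le q$, for all $1\le p,q\le k$. In particular, $A_s$ has the $d_s$-order property, where $$d_s\ \ge\ \operatorname{twr}(s-1)=\operatorname{twr}\bigl(\lfloor 1/(16\epsilon)\rfloor-1\bigr)\qquad\text{and}\qquad d_s\ge\tfrac12\log_2|G|,$$ and $d_s=(1-o(1))\log_2|G|$ as $\epsilon\to0$. In particular, for each fixed $k$, the set $A_s$ fails to be $k$-stable once $\epsilon$ is sufficiently small.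
   Context: Tower function: $\operatorname{twr}(0)=1$, $\operatorname{twr}(r+1)=2^{\operatorname{twr}(r)}$. For $u,v\in\mathbb F_2^m$, $\langle u,v\rangle=\sum_j u_jv_j\in\mathbb F_2$. Order property and stability: a set $A\subseteq G$ has the $k$-order property if there are $a_1,\dots,a_k,b_1,\dots,b_k\in G$ with $a_p+b_q\in A\iff p\le q$ for all $1\le p,q\le k$ (such a configuration is a ladder of length $k$). $A$ is $k$-stable if it contains no ladder of length $k$. HLM construction. Fix $0<\epsilon\le1/256$ and $s=\lfloor1/(16\epsilon)\rfloor\ge16$. Define $d_1=1$, $D_0=0$, $D_i=\sum_{j\le i}d_j$, and $d_{i+1}=2^{D_i}$ for $i=1,2$, $d_{i+1}=2^{D_i-3}$ for $i\ge3$ (so $d_1,\dots,d_4=1,2,8,2^8$). Put $n=D_s$ and $G=\mathbb F_2^{\,n}$. Split coordinates into $s$ consecutive blocks, $x=(x^1,\dots,x^s)$ with $x^i\in\mathbb F_2^{d_i}$, and write $x^{<i}=(x^1,\dots,x^{i-1})\in\mathbb F_2^{D_{i-1}}$. An admissible HLM realization is a family of maps $\xi_i:\mathbb F_2^{D_{i-1}}\to\mathbb F_2^{d_i}$ ($1\le i\le s$), with images $\Xi_i=\xi_i(\mathbb F_2^{D_{i-1}})$, such that for every $i$: $\xi_i(u)\ne0$ for all $u$; $\Xi_i$ spans $\mathbb F_2^{d_i}$; $\xi_i$ is injective; for $i\le3$ the image $\Xi_i$ is a basis of $\mathbb F_2^{d_i}$; and for $i>3$ (where $|\Xi_i|=2^{D_{i-1}}=8d_i$)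 every subset of $\Xi_i$ containing at least $3|\Xi_i|/4$ vectors spans $\mathbb F_2^{d_i}$. The level sets are $A_i=\{x\in G:\langle x^i,\xi_i(x^{<i})\rangle=0\}$. *)

(* Defs.v *)
From HB Require Import structures.
From mathcomp Require Import all_boot all_order all_algebra.
From mathcomp Require Import all_classical all_reals all_analysis.

Set Implicit Arguments.
Unset Strict Implicit.
Unset Printing Implicit Defensive.

Import Order.TTheory GRing.Theory Num.Theory.
Import numFieldNormedType.Exports.
Local Open Scope ring_scope.

Fixpoint twr (r : nat) : nat := if r is r'.+1 then (2 ^ twr r')%N else 1%N.

(* Indices p, q range over {0, ..., k-1} instead of {1, ..., k}. *)
Definition is_ladder (G : finZmodType) (A : {set G}) (k : nat)
    (a b : 'I_k -> G) : Prop :=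
  forall p q : 'I_k, a p + b q \in A <-> (p <= q)%N.

Definition order_property (G : finZmodType) (A : {set G}) (k : nat) : Prop :=
  exists a b : 'I_k -> G, is_ladder A a b.

Definition stable (G : finZmodType) (A : {set G}) (k : nat) : Prop :=
  ~ order_property A k.

Definition dotp (m : nat) (u v : 'rV['F_2]_m) : 'F_2 :=
  \sum_(j < m) u 0 j * v 0 j.

Definition log2 (R : realType) (x : R) : R := ln x / ln 2.

(* d_(i+1), computed from i and D_i *)
Definition hlm_next (i Di : nat) : nat :=
  if i == 0%N then 1%N
  else if (i <= 2)%N then (2 ^ Di)%N
  else (2 ^ (Di - 3))%N.

Fixpoint hlm_D (i : nat) : nat :=
  if i is j.+1 then (hlm_D j + hlm_next j (hlm_D j))%N else 0%N.

(* Blocks are numbered from 1; the value d_0 = 0 is a convention. *)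
Definition hlm_d (i : nat) : nat :=
  if i is j.+1 then hlm_next j (hlm_D j) else 0%N.

Lemma hlm_DE i : hlm_D i = (\sum_(1 <= j < i.+1) hlm_d j)%N.
Proof.
elim: i => [|i IH]; first by rewrite big_geq.
by rewrite big_nat_recr //= -IH.
Qed.

Lemma hlm_d1234 : [seq hlm_d i | i <- [:: 1; 2; 3; 4]%N] = [:: 1; 2; 8; 2 ^ 8]%N.
Proof. by []. Qed.

Lemma hlm_D_mono (i j : nat) : (i <= j)%N -> (hlm_D i <= hlm_D j)%N.
Proof.
apply: (homo_leq (f := hlm_D) (r := leq)) => [//|? ? ?|k]; first exact: leq_trans.
exact: leq_addr.
Qed.

Lemma hlm_prefix_le (s i : nat) : (i <= s)%N -> (hlm_D i.-1 <= hlm_D s)%N.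
Proof. by move=> his; apply/hlm_D_mono/(leq_trans (leq_pred i)). Qed.

Lemma hlm_block_lt (s i : nat) (his : (i <= s)%N) (j : 'I_(hlm_d i)) :
  (hlm_D i.-1 + j < hlm_D s)%N.
Proof.
case: i his j => [_ [] //|i his j] /=.
by apply: leq_trans (hlm_D_mono his); rewrite /= ltn_add2l.
Qed.

Notation hlm_group s := 'rV['F_2]_(hlm_D s).

(* x^i *)
Definition hlm_block (s i : nat) (his : (i <= s)%N) (x : hlm_group s) :
    'rV['F_2]_(hlm_d i) :=
  \row_(j < hlm_d i) x 0 (Ordinal (hlm_block_lt his j)).

(* x^{<i} *)
Definition hlm_prefix (s i : nat) (his : (i <= s)%N) (x : hlm_group s) :
    'rV['F_2]_(hlm_D i.-1) :=
  \row_(j < hlm_D i.-1) x 0 (widen_ord (hlm_prefix_le his) j).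

(* A realization only constrains and uses the maps of index 1 <= i <= s; the
   remaining members of the family are irrelevant. *)
Definition hlm_family : Type :=
  forall i : nat, 'rV['F_2]_(hlm_D i.-1) -> 'rV['F_2]_(hlm_d i).

Definition hlm_image (xi : hlm_family) (i : nat) : {set 'rV['F_2]_(hlm_d i)} :=
  [set xi i u | u : 'rV['F_2]_(hlm_D i.-1)].

Definition spans (m : nat) (S : {set 'rV['F_2]_m}) : bool :=
  (<<enum S>> == fullv)%VS.

Record admissible (s : nat) (xi : hlm_family) : Prop := Admissible {
  adm_neq0 : forall i, (1 <= i <= s)%N -> forall u, xi i u != 0;
  adm_spans : forall i, (1 <= i <= s)%N -> spans (hlm_image xi i);
  adm_inj : forall i, (1 <= i <= s)%N -> injective (xi i);
  adm_basis : forall i, (1 <= i <= s)%N -> (i <= 3)%N ->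
    basis_of fullv (enum (hlm_image xi i));
  adm_robust : forall i, (1 <= i <= s)%N -> (3 < i)%N ->
    forall S : {set 'rV['F_2]_(hlm_d i)}, S \subset hlm_image xi i ->
      (3 * #|hlm_image xi i| <= 4 * #|S|)%N -> spans S
}.

Definition level_set (s : nat) (xi : hlm_family) (i : nat) (his : (i <= s)%N) :
    {set hlm_group s} :=
  [set x | dotp (hlm_block his x) (xi i (hlm_prefix his x)) == 0].

Definition hlm_s (R : realType) (eps : R) : nat := Num.truncn (1 / (16 * eps)).

(* Main.v *)
(* Choose [hlm_d i] linearly independent vectors [eta_p = xi i (u_p)] in the
   image of [xi i].  Let [a_p] have prefix [u_p] and zero block [i], and let
   [b_q] have zero prefix and a block [i] dual to the [eta_p] in the sense that
   its dot product with [eta_p] is [1] exactly when [q < p].  The prefix of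
   [a_p + b_q] is then [u_p], so its membership in the level set is read off
   from [dotp b_q^i eta_p].

   For the asymptotics, [D_s = D_(s-1) + d_s] with [d_s = 2 ^ (D_(s-1) - 3)],
   so that [1 - d_s / D_s = D_(s-1) / D_s] is at most [1 / D_(s-1)]. *)
Require Import Defs.
From HB Require Import structures.
From mathcomp Require Import all_boot all_order all_algebra.
From mathcomp Require Import all_classical all_reals all_analysis.
From mathcomp Require Import zify lra.

Set Implicit Arguments.
Unset Strict Implicit.
Unset Printing Implicit Defensive.

Import Order.TTheory GRing.Theory Num.Theory.
Import numFieldNormedType.Exports.
Local Open Scope classical_set_scope.
Local Open Scope ring_scope.

Lemma order_property_le (G : finZmodType) (A : {set G}) (k l : nat) :
  (k <= l)%N -> order_property A l -> order_property A k.
Proof.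
move=> kl [a [b lad]].
exists (fun p => a (widen_ord kl p)), (fun p => b (widen_ord kl p)) => p q.
exact: lad.
Qed.

(** Each row of the identity matrix is a combination of vectors of [S], so it lies in the row space
    of [M]. This turns spanning into a statement about matrix rank. *)
Lemma spans_row_full (m n : nat) (S : {set 'rV['F_2]_m}) (M : 'M['F_2]_(n, m)) :
  (forall v, v \in S -> (v <= M)%MS) -> spans S -> row_full M.
Proof.
move=> SM /eqP spanS; rewrite -sub1mx; apply/row_subP => i.
have : row i 1%:M \in <<enum S>>%VS by rewrite spanS memvf.
rewrite -[enum S]in_tupleE => /coord_span ->.
apply: summx_sub => j _; apply/scalemx_sub/SM.
by rewrite -mem_enum in_tupleE mem_nth.
Qed.

Lemma exists_dual (m d : nat) (T : finType) (f : T -> 'rV['F_2]_d)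
    (c : 'I_d -> 'I_m -> 'F_2) :
  spans [set f t | t : T] ->
  exists (t : 'I_d -> T) (b : 'I_m -> 'rV['F_2]_d),
    forall p q, dotp (b q) (f (t p)) = c p q.
Proof.
pose M := \matrix_(i < #|T|) f (enum_val i).
move=> spanf; have fullM : row_full M.
  apply: spans_row_full spanf => _ /imsetP[t _ ->].
  by rewrite -[t]enum_rankK -(rowK (fun i => f (enum_val i))) row_sub.
(* [E] keeps [d] independent rows of [M], hence is invertible; column [q] of [B] then solves the
   linear system prescribing the products with [b q]. *)
pose E := rowsub (fullrankfun fullM) M.
pose B := invmx E *m \matrix_(p, q) c p q.
exists (fun p => enum_val (fullrankfun fullM p)), (fun q => (col q B)^T) => p q.
transitivity ((E *m B) p q); last by rewrite mulKVmx ?fullrowsub_unit // mxE.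
by rewrite [RHS]mxE; apply: eq_bigr => j _; rewrite !mxE mulrC.
Qed.

Section Coordinates.
Variables (s i : nat) (his : (i <= s)%N).

(** The default values after [insub] put zeros in all coordinates beyond block [i]. *)
Definition hlm_lift (u : 'rV['F_2]_(hlm_D i.-1)) (w : 'rV['F_2]_(hlm_d i)) :
    hlm_group s :=
  \row_j if (j < hlm_D i.-1)%N then oapp (u 0) 0 (insub (j : nat))
         else oapp (w 0) 0 (insub (j - hlm_D i.-1)%N).

Lemma hlm_prefix_lift u w : hlm_prefix his (hlm_lift u w) = u.
Proof. by apply/rowP => j; rewrite !mxE /= ltn_ord valK. Qed.

Lemma hlm_block_lift u w : hlm_block his (hlm_lift u w) = w.
Proof.
by apply/rowP => j; rewrite !mxE /= ltnNge leq_addr /= addKn valK.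
Qed.

Lemma hlm_prefixD x y :
  hlm_prefix his (x + y) = hlm_prefix his x + hlm_prefix his y.
Proof. by apply/rowP => j; rewrite !mxE. Qed.

Lemma hlm_blockD x y :
  hlm_block his (x + y) = hlm_block his x + hlm_block his y.
Proof. by apply/rowP => j; rewrite !mxE. Qed.

Lemma level_set_order_property (xi : hlm_family) :
  spans (hlm_image xi i) -> order_property (level_set xi his) (hlm_d i).
Proof.
move=> /(exists_dual (fun p q : 'I_(hlm_d i) => (q < p)%N%:R)) [u [b bE]].
exists (fun p => hlm_lift (u p) 0), (fun q => hlm_lift 0 (b q)) => p q.
rewrite inE hlm_prefixD hlm_blockD !hlm_prefix_lift !hlm_block_lift.
by rewrite addr0 add0r bE ltnNge; case: (p <= q)%N; rewrite ?oner_eq0 ?eqxx.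
Qed.

End Coordinates.

Lemma hlm_dS (i : nat) : (2 < i)%N -> hlm_d i.+1 = (2 ^ (hlm_D i - 3))%N.
Proof. by case: i => [|[|[|i]]]. Qed.

Lemma hlm_DS (i : nat) : hlm_D i.+1 = (hlm_D i + hlm_d i.+1)%N.
Proof. by []. Qed.

Lemma hlm_D_ge (i : nat) : (i <= hlm_D i)%N.
Proof.
elim: i => // i IH; apply: leq_ltn_trans IH _.
rewrite hlm_DS -[ltnLHS]addn0 ltn_add2l /= /hlm_next.
by do 2?case: ifP => _; rewrite ?expn_gt0.
Qed.

Lemma hlm_D_ge11 (i : nat) : (2 < i)%N -> (11 <= hlm_D i)%N.
Proof. exact: (@hlm_D_mono 3). Qed.

(** The 3 lost in the exponent is paid for by the earlier blocks: $D_{i+1} - 3 = d_{i+1} + (D_i - 3)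
    \ge d_{i+1}$ because $D_i \ge D_2 = 3$. The small cases are computed. *)
Lemma twr_le_hlm_d (i : nat) : (twr i <= hlm_d i.+1)%N.
Proof.
case: i => [|[|[|i]]] //; elim: i => [|i IH] //.
rewrite hlm_dS // leq_exp2l // (leq_trans IH) // hlm_DS.
by rewrite addnC -addnBA ?leq_addr // (@hlm_D_mono 2).
Qed.

(** The threshold 11 is $D_3$, where $121 \le 256$. Each further step doubles the right side, while
    $(n+1)^2 \le 2n^2$. *)
Lemma sqrn_le_exp2 (n : nat) : (11 <= n)%N -> (n ^ 2 <= 2 ^ (n - 3))%N.
Proof.
move=> /subnK <-; elim: (n - 11)%N => // m.
rewrite addSn subSn ?(leq_trans _ (leq_addl _ _)) //.
by rewrite [(2 ^ _.+1)%N]expnS -!mulnn; move: (2 ^ _)%N => e; nia.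
Qed.

Lemma hlm_D_sqr_le (i : nat) : (2 < i)%N -> (hlm_D i ^ 2 <= hlm_d i.+1)%N.
Proof. by move=> i2; rewrite hlm_dS // sqrn_le_exp2 // hlm_D_ge11. Qed.

Lemma hlm_D_le_d (i : nat) : (2 < i)%N -> (hlm_D i <= hlm_d i.+1)%N.
Proof.
move=> i2; apply: leq_trans (hlm_D_sqr_le i2).
by rewrite leq_pmulr // (leq_trans _ (hlm_D_ge11 i2)).
Qed.

Section Reals.
Variable R : realType.
Implicit Type eps : R.

Lemma log2_card_rV (n : nat) : log2 (#|{: 'rV['F_2]_n}|%:R : R) = n%:R.
Proof.
rewrite card_mx mul1n card_Fp // natrX /log2 lnXn // mulrnAl.
by rewrite divff // gt_eqF // ln_gt0 // ltr1n.
Qed.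

Lemma hlm_s_ge eps (k : nat) : 0 < eps -> 16 * k%:R * eps <= 1 ->
  (k <= hlm_s eps)%N.
Proof.
move=> eps0 keps; rewrite truncn_ge_nat ?divr_ge0 ?mulr_ge0 ?(ltW eps0) //.
by rewrite ler_pdivlMr ?mulr_gt0 //; lra.
Qed.

Lemma hlm_s_gt eps : 0 < eps -> 1 < 16 * eps * ((hlm_s eps)%:R + 1).
Proof.
move=> eps0; have := truncnS_gt (1 / (16 * eps)).
by rewrite ltr_pdivrMr ?mulr_gt0 // -natr1; lra.
Qed.

Lemma hlm_s_ge16 eps : 0 < eps <= 1 / 256 -> (16 <= hlm_s eps)%N.
Proof. by case/andP => eps0 eps1; apply: hlm_s_ge => //; lra. Qed.

(** From $D_i^2 \le d_{i+1}$ the ratio is at most $1/D_i$. The weaker bound $1/i$ suffices, and it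
    compares directly with [eps] when $i = s - 1$. *)
Lemma hlm_D_pred_ratio (i : nat) : (2 < i)%N ->
  (hlm_D i)%:R / (hlm_D i.+1)%:R <= i%:R^-1 :> R.
Proof.
move=> i2; have i0 : (0 < i)%N by apply: leq_trans i2.
rewrite ler_pdivrMr ?ltr0n ?(leq_trans _ (hlm_D_ge _)) //.
rewrite mulrC ler_pdivlMr ?ltr0n // -natrM ler_nat.
have := hlm_D_sqr_le i2; have := hlm_D_ge i; rewrite hlm_DS; nia.
Qed.

Lemma hlm_defectE (i : nat) :
  1 - (hlm_d i.+1)%:R / (hlm_D i.+1)%:R = (hlm_D i)%:R / (hlm_D i.+1)%:R :> R.
Proof.
have D0 : (hlm_D i.+1)%:R != 0 :> R.
  by rewrite pnatr_eq0 -lt0n (leq_trans _ (hlm_D_ge _)).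
by rewrite -{1}(divff D0) -mulrBl {1}hlm_DS natrD addrK.
Qed.

Lemma hlm_defect_le eps : 0 < eps <= 1 / 256 ->
  1 - (hlm_d (hlm_s eps))%:R / (hlm_D (hlm_s eps))%:R <= 32 * eps.
Proof.
move=> heps; have := hlm_s_ge16 heps; case/andP: heps => eps0 _.
have := hlm_s_gt eps0; case: (hlm_s eps) => // i gts; rewrite ltnS => i15.
have i2 : (2 < i)%N by apply: leq_trans i15.
rewrite hlm_defectE; apply: le_trans (hlm_D_pred_ratio i2) _.
(* With $s = i + 1$, [gts] says $1 < 16\epsilon(i+2)$. Since $i + 2 \le 2i$, this gives $1/i \le
   32\epsilon$. *)
have i15R : 15 <= i%:R :> R by rewrite ler_nat.
rewrite invf_ple ?posrE ?mulr_gt0 //; last by lra.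
rewrite -div1r ler_pdivrMr ?mulr_gt0 //; move: gts; rewrite -natr1; nra.
Qed.

End Reals.

Theorem theorem3p1 (R : realType) :
  [/\ (forall (eps : R) (xi : hlm_family),
         0 < eps <= 1 / 256 -> admissible (hlm_s eps) xi ->
         [/\ forall (i : nat) (his : (i <= hlm_s eps)%N), (1 <= i)%N ->
               forall k : nat, (1 <= k <= hlm_d i)%N ->
                 order_property (level_set xi his) k,
             order_property (level_set xi (leqnn (hlm_s eps)))
               (hlm_d (hlm_s eps)),
             (twr (hlm_s eps - 1) <= hlm_d (hlm_s eps))%N
           & 1 / 2 * log2 (#|{: hlm_group (hlm_s eps)}|%:R : R)
               <= (hlm_d (hlm_s eps))%:R]),
      (exists2 delta : R -> R,
         delta eps @[eps --> 0^'+] --> (0 : R)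
       & forall eps : R, 0 < eps <= 1 / 256 ->
           (hlm_d (hlm_s eps))%:R =
             (1 - delta eps) * log2 (#|{: hlm_group (hlm_s eps)}|%:R : R))
    & (forall k : nat, exists2 eps0 : R, 0 < eps0
       & forall (eps : R) (xi : hlm_family),
           0 < eps <= eps0 -> eps <= 1 / 256 ->
           admissible (hlm_s eps) xi ->
           ~ stable (level_set xi (leqnn (hlm_s eps))) k)].
Proof.
have order_s (eps : R) xi : 0 < eps <= 1 / 256 -> admissible (hlm_s eps) xi ->
    order_property (level_set xi (leqnn (hlm_s eps))) (hlm_d (hlm_s eps)).
  move=> heps adm; apply/level_set_order_property/(adm_spans adm).
  by rewrite leqnn (leq_trans _ (hlm_s_ge16 heps)).
split.
- move=> eps xi heps adm; split; last 2 first.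
  + have := hlm_s_ge16 heps; case: (hlm_s eps) => // i _.
    by rewrite subn1 twr_le_hlm_d.
  + rewrite log2_card_rV; have := hlm_s_ge16 heps; case: (hlm_s eps) => // i.
    rewrite ltnS => i15.
    (* The last block is at least as long as all the earlier ones together, so it fills at least
       half of the coordinates. *)
    have : (hlm_D i <= hlm_d i.+1)%N by rewrite hlm_D_le_d // (leq_trans _ i15).
    by rewrite hlm_DS natrD -(ler_nat R); lra.
  + move=> i his i1 k /andP[_ kd]; apply: (order_property_le kd).
    by apply/level_set_order_property/(adm_spans adm); rewrite i1.
  + exact: order_s.
(* Taking [delta] to be the exact defect $1 - d_s/D_s$ makes the equation an identity; the limit
   follows by squeezing between $0$ and $32\epsilon$. *)
- exists (fun eps => 1 - (hlm_d (hlm_s eps))%:R / (hlm_D (hlm_s eps))%:R).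
  + apply: (squeeze_cvgr (f := cst 0) (h := fun eps : R => 32 * eps)).
    * near=> eps; have heps : 0 < eps <= 1 / 256.
        by apply/andP; split=> //; near: eps; apply: nbhs_right_le; lra.
      rewrite hlm_defect_le // andbT; have := hlm_s_ge16 heps.
      by case: (hlm_s eps) => // i _; rewrite hlm_defectE divr_ge0.
    * exact: cvg_cst.
    * rewrite -[X in _ --> X](mulr0 32); apply: cvgMr.
      exact: cvg_at_right_filter.
  + move=> eps heps; rewrite log2_card_rV subKr divfK // pnatr_eq0 -lt0n.
    by rewrite (leq_trans _ (hlm_D_ge _)) // (leq_trans _ (hlm_s_ge16 heps)).
(* This choice forces $s \ge k + 1$, whence $k \le s - 1 \le D_{s-1} \le d_s$ and the ladder of
   length $d_s$ can be truncated to length $k$. *)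
- move=> k; exists (16 * k.+1%:R)^-1; first by rewrite invr_gt0 mulr_gt0.
  move=> eps xi /andP[eps0 eps1] eps2 adm; apply.
  have heps : 0 < eps <= 1 / 256 by rewrite eps0.
  apply: order_property_le (order_s _ _ heps adm).
  have : (k < hlm_s eps)%N.
    apply: hlm_s_ge => //.
    by rewrite mulrC -ler_pdivlMr ?mulr_gt0 // div1r.
  have := hlm_s_ge16 heps; case: (hlm_s eps) => // i.
  rewrite !ltnS => i15 ki; rewrite (leq_trans ki) // (leq_trans (hlm_D_ge i)) //.
  by rewrite hlm_D_le_d // (leq_trans _ i15).
Unshelve. all: by end_near.
Qed.
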